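(* Let $X$ be a connected locally finite preordered set, $R$ a $T$-algebra and $K=I(X,R)$. Then (as $T$-modules): 1(a). $\Omega=D_L+\mathrm{In}(\mathrm{Der}\,L)$ and $\Omega/\mathrm{In}(\mathrm{Der}\,L)\cong\mathrm{Out}\,R$. 1(b). $\Lambda=\mathrm{In}_0(\mathrm{Der}\,K)+(\Psi\oplus D_K)$ and $$\mathrm{Der}\,K=\mathrm{In}(\mathrm{Der}\,K)+(\Psi\oplus D_K)=\mathrm{In}_1(\mathrm{Der}\,K)\oplus\big(\mathrm{In}_0(\mathrm{Der}\,K)+(\Psi\oplus D_K)\big).$$ 2. $\mathrm{Out}\,K\cong\Psi/\Psi_0\oplus\mathrm{Out}\,R$.
   Context: Rings are associative with nonzero identity; $T$ is a commutative ring. $(X,\le)$ is a preordered set (reflexive, transitive) all of whose intervals $\{z:x\le z\le y\}$ are finite; $x\sim y$ iff $x\le y$ and $y\le x$. $X$ is connected if any two elements are joined by a finite sequence in which consecutive elements are comparable. $K=I(X,R)$ is the $T$-algebra of functions $f:X\times X\to R$ with $f(x,y)=0$ if $x\not\le y$, pointwise addition and $T$-action, product $(fg)(x,y)=\sum_{x\le z\le y}f(x,z)g(z,y)$. $L=\{f: f(x,y)=0\text{ if }x\not\sim y\}$ (subalgebra), $M=\{f: f(x,y)=0\text{ if }x\sim y\}$ (ideal), $K=L\oplus M$. For a $T$-algebra $A$: $\mathrm{Der}\,A$ is the $T$-module of derivations ($T$-linear $d$ with $d(ab)=d(a)b+ad(b)$), $d_c(a)=ac-ca$ is the inner derivation defined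 by $c$, $\mathrm{In}(\mathrm{Der}\,A)$ the submodule of inner derivations, $\mathrm{Out}\,A=\mathrm{Der}\,A/\mathrm{In}(\mathrm{Der}\,A)$. $\mathrm{In}_0(\mathrm{Der}\,K)$ (resp. $\mathrm{In}_1(\mathrm{Der}\,K)$): inner derivations of $K$ defined by elements of $L$ (resp. $M$). Every derivation $d$ of $K$ satisfies $d(M)\subseteq M$, so $d(a+b)=\alpha(a)+(\delta(a)+\beta(b))$ for $a\in L,b\in M$, with $\alpha:L\to L$, $\delta:L\to M$, $\beta:M\to M$ $T$-linear and $\alpha\in\mathrm{Der}\,L$. $\Omega\subseteq\mathrm{Der}\,L$ is the image of the homomorphism $d\mapsto\alpha$. $\Lambda$: derivations with $\delta=0$. $\Psi$: derivations with $\alpha=0,\delta=0$. $\Psi_0$: inner derivations of $K$ defined by central elements of the ring $L$. Ring derivations: each $\varepsilon\in\mathrm{Der}\,R$ gives a derivation $\overline\varepsilon$ of $K$, $\overline\varepsilon(g)(x,y)=\varepsilon(g(x,y))$, which restricts to a derivation $\varepsilon_L$ of $L$. $D_K=\{\overline\varepsilon:\varepsilon\in\mathrm{Der}\,R\}\subseteq\mathrm{Der}\,K$ and $D_L=\{\varepsilon_L:\varepsilon\in\mathrm{Der}\,R\}\subseteq\mathrm{Der}\,L$. *)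

(* Defs.v *)
From HB Require Import structures.
From mathcomp Require Import all_boot all_order all_algebra finmap.
From mathcomp Require Import boolp classical_sets functions cardinality fsbigop.

Set Implicit Arguments.
Unset Strict Implicit.
Unset Printing Implicit Defensive.

Import Order.TTheory GRing.Theory.
Local Open Scope classical_set_scope.
Local Open Scope ring_scope.
Local Open Scope quotient_scope.

(* Submodules of [V : lmodType T] are boolean predicates closed under the     *)
(* module operations ([submodClosed V]); [`[< P >]] turns [P : Prop] into a   *)
(* boolean.                                                                   *)
Section Modules.
Variable T : pzRingType.
Implicit Types U V W : lmodType T.

Definition lmod_iso U V := exists f : {linear U -> V}, bijective f.

Definition addm V (S1 S2 : {pred V}) : {pred V} :=
  fun v => `[< exists u w, [/\ u \in S1, w \in S2 & v = u + w] >].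

Definition independent V (S1 S2 : {pred V}) :=
  forall v, v \in S1 -> v \in S2 -> v = 0.

Definition imagem U V (f : U -> V) (S : {pred U}) : {pred V} :=
  fun v => `[< exists2 u, u \in S & v = f u >].

Lemma submod_closed_predT V : GRing.submod_closed (predT : {pred V}).
Proof. by []. Qed.

Lemma submod_closed_imagem U V (f : {linear U -> V}) (S : {pred U}) :
  GRing.submod_closed S -> GRing.submod_closed (imagem f S).
Proof.
move=> [S0 SD]; split; first by apply/asboolP; exists 0; rewrite // linear0.
move=> t _ _ /asboolP[u Su ->] /asboolP[v Sv ->]; apply/asboolP.
by exists (t *: u + v); [exact: SD|rewrite linearP].
Qed.

Record subm V (S : submodClosed V) := Subm {
  subm_val :> V;
  _ : subm_val \in S }.

HB.instance Definition _ V (S : submodClosed V) := [isSub for @subm_val V S].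
HB.instance Definition _ V (S : submodClosed V) := [Choice of subm S by <:].
HB.instance Definition _ V (S : submodClosed V) :=
  [SubChoice_isSubLmodule of subm S by <:].

Section Quotient.
Variables (V : lmodType T) (N : submodClosed V).

(* mathcomp's [submodClosed] does not inherit from [zmodClosed] *)
Definition zmod_pred : {pred V} := N.

Lemma zmod_pred_closed : zmod_closed zmod_pred.
Proof.
split=> [|u v Nu Nv]; first exact: (rpred0 N).
by apply: (@rpredD V N) => //; rewrite -scaleN1r; exact: (@rpredZ _ V N).
Qed.

HB.instance Definition _ := GRing.isZmodClosed.Build V zmod_pred zmod_pred_closed.

Definition quotm := Quotient.quot zmod_pred.
HB.instance Definition _ := GRing.Zmodule.on quotm.
HB.instance Definition _ := EqQuotient.on quotm.

Local Notation pi := (\pi_(Quotient.quot zmod_pred) : V -> quotm).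

Definition scaleq (t : T) (x : quotm) : quotm := pi (t *: repr x).

Lemma pi_scaleq t v : scaleq t (pi v) = pi (t *: v).
Proof.
have vE : repr (pi v) - v \in zmod_pred by rewrite Quotient.idealrBE reprK.
have : t *: repr (pi v) == t *: v %[mod Quotient.quot zmod_pred].
  by rewrite -Quotient.idealrBE -scalerBr; exact: (@rpredZ _ V N).
by move/eqP.
Qed.

Lemma pi_addq u v : pi (u + v) = pi u + pi v.
Proof. exact: (@Quotient.pi_add V zmod_pred). Qed.

Lemma quotmW (P : quotm -> Prop) : (forall v, P (pi v)) -> forall x, P x.
Proof. by move=> Ppi x; rewrite -[x](@reprK _ (Quotient.quot zmod_pred)). Qed.

Let scaleqA s t x : scaleq s (scaleq t x) = scaleq (s * t) x.
Proof. by elim/quotmW: x => v; rewrite !pi_scaleq scalerA. Qed.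

Let scaleq1 : left_id 1 scaleq.
Proof. by elim/quotmW => v; rewrite pi_scaleq scale1r. Qed.

Let scaleqDr : right_distributive scaleq +%R.
Proof.
move=> t; elim/quotmW => u; elim/quotmW => v.
by rewrite -pi_addq !pi_scaleq scalerDr pi_addq.
Qed.

Let scaleqDl x : {morph scaleq^~ x : s t / s + t}.
Proof.
by elim/quotmW: x => v s t; rewrite !pi_scaleq scalerDl pi_addq.
Qed.

HB.instance Definition _ := GRing.Zmodule_isLmodule.Build T quotm
  scaleqA scaleq1 scaleqDr scaleqDl.

End Quotient.

(* [N] seen as a submodule of [S]; it is used with [N] contained in [S]       *)
Definition inside V (S : submodClosed V) (N : {pred V}) : {pred subm S} :=
  fun v => val v \in N.
#[global] Arguments inside {V} S N v.

Lemma inside_closed V (S N : submodClosed V) :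
  GRing.submod_closed (inside S N).
Proof.
split=> [|t u v uN vN]; rewrite -topredE /= /inside.
  by rewrite (raddf0 (val : subm S -> V)); exact: (rpred0 N).
rewrite (linearP (val : subm S -> V)); apply: (@rpredD V N) => //.
exact: (@rpredZ _ V N).
Qed.

HB.instance Definition _ V (S N : submodClosed V) :=
  GRing.isSubmodClosed.Build T (subm S) (inside S N)
    (GRing.submod_closed_semi (inside_closed S N)).

Definition subquot V (S N : submodClosed V) : lmodType T :=
  quotm (inside S N).

End Modules.
#[global] Arguments inside {T V} S N v.

Section Derivations.
Variables (T : comNzRingType) (A : algType T).

Definition derivation : {pred (A -> A)} := fun d =>
  `[< linear d /\ (forall a b, d (a * b) = d a * b + a * d b) >].

Record Der := MkDer { der_fun :> A -> A; _ : der_fun \in derivation }.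

Lemma derivation_closed : GRing.submod_closed derivation.
Proof.
split.
  by apply/asboolP; split=> [t a b|a b] /=; rewrite ?scaler0 ?mul0r ?mulr0 addr0.
move=> t d e /asboolP[dl dM] /asboolP[el eM].
apply/asboolP; split=> [s a b|a b]; rewrite !fctE.
  rewrite dl el !scalerDr !scalerA (mulrC t s) -!addrA; congr (_ + _).
  by rewrite addrCA.
rewrite dM eM scalerDr mulrDl mulrDr -scalerAl -scalerAr -!addrA; congr (_ + _).
by rewrite addrCA.
Qed.

HB.instance Definition _ := GRing.isSubmodClosed.Build T (A -> A) derivation
  (GRing.submod_closed_semi derivation_closed).
HB.instance Definition _ := [isSub for der_fun].
HB.instance Definition _ := [Choice of Der by <:].
HB.instance Definition _ := [SubChoice_isSubLmodule of Der by <:].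

Lemma der_is_linear (d : Der) : linear d.
Proof. by case: d => d /= /asboolP[]. Qed.

HB.instance Definition _ (d : Der) :=
  GRing.isLinear.Build T A A *:%R (der_fun d) (der_is_linear d).

Lemma derM (d : Der) a b : d (a * b) = d a * b + a * d b.
Proof. by case: d => d /= /asboolP[]. Qed.

Lemma der_ext (d e : Der) : d =1 e -> d = e.
Proof. by move=> de; apply/val_inj/funext. Qed.

Lemma derDE (d e : Der) a : (d + e) a = d a + e a.
Proof. by have /(congr1 (@^~ a)) := raddfD (val : Der -> _) d e. Qed.

Lemma derZE t (d : Der) a : (t *: d) a = t *: d a.
Proof. by have /(congr1 (@^~ a)) := linearZZ (val : Der -> _) t d. Qed.

Lemma ad_subproof (c : A) : (fun a => a * c - c * a) \in derivation.
Proof.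
apply/asboolP; split=> [t a b|a b].
  rewrite mulrDl mulrDr -scalerAl -scalerAr scalerBr.
  by rewrite opprD addrACA.
by rewrite mulrBl mulrBr !mulrA [RHS]addrC addrA subrK.
Qed.

Definition ad (c : A) : Der := MkDer (ad_subproof c).

Lemma ad_is_linear : linear ad.
Proof.
move=> t b c; apply: der_ext => a; rewrite derDE derZE /=.
by rewrite mulrDl mulrDr -scalerAl -scalerAr scalerBr opprD addrACA.
Qed.

HB.instance Definition _ := GRing.isLinear.Build T A Der *:%R ad ad_is_linear.

Definition inner : {pred Der} := imagem ad predT.

HB.instance Definition _ := GRing.isSubmodClosed.Build T Der inner
  (GRing.submod_closed_semi (submod_closed_imagem ad (@submod_closed_predT _ A))).

Definition Out : lmodType T := quotm inner.

End Derivations.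
#[global] Arguments derivation {T} A d.
#[global] Arguments inner {T} A _.

(* Rings have a nonzero identity, so [X] has to be nonempty for the incidence *)
(* algebra to be one.                                                         *)
HB.mixin Record isLocallyFinite d X of Order.Preorder d X := {
  finite_interval : forall x y : X, finite_set [set z | (x <= z <= y)%O];
  lf_inhabited : inhabited X }.

#[short(type="lfPreorderType")]
HB.structure Definition LocallyFinitePreorder d :=
  {X of Order.Preorder d X & isLocallyFinite d X}.

Definition ord_equiv d (X : preorderType d) (x y : X) := (x <= y)%O && (y <= x)%O.

Definition connected_preorder d (X : preorderType d) :=
  forall x y : X, exists s : seq X, path >=<%O x s /\ last x s = y.

Section Incidence.
Variables (d : Order.disp_t) (X : lfPreorderType d).

Definition incidence_fun (R : zmodType) : {pred (X -> X -> R)} :=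
  fun f => `[< forall x y, ~~ (x <= y)%O -> f x y = 0 >].

#[local] Arguments incidence_fun R : clear implicits.

Record incidence (R : zmodType) := Incidence {
  inc_fun :> X -> X -> R;
  _ : inc_fun \in incidence_fun R }.

Section Zmod.
Variable R : zmodType.

Lemma incidence_zmod_closed : zmod_closed (incidence_fun R).
Proof.
split; first exact/asboolP.
move=> f g /asboolP f0 /asboolP g0; apply/asboolP => x y xy.
by rewrite !fctE f0 // g0 // subr0.
Qed.

HB.instance Definition _ :=
  GRing.isZmodClosed.Build (X -> X -> R) (incidence_fun R)
    incidence_zmod_closed.
HB.instance Definition _ := [isSub for @inc_fun R].
HB.instance Definition _ := [Choice of incidence R by <:].
HB.instance Definition _ := [SubChoice_isSubZmodule of incidence R by <:].

Lemma inc_ext (f g : incidence R) : (forall x y, f x y = g x y) -> f = g.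
Proof. by move=> fg; apply/val_inj/funext => x; apply/funext => y; exact: fg. Qed.

Lemma inc0 (f : incidence R) x y : ~~ (x <= y)%O -> f x y = 0.
Proof. by case: f => f /= /asboolP f0; exact: f0. Qed.

Lemma incDE (f g : incidence R) x y : (f + g) x y = f x y + g x y.
Proof. by have /(congr1 (fun h => h x y)) := raddfD (val : incidence R -> _) f g. Qed.

Lemma inc0E x y : (0 : incidence R) x y = 0.
Proof. by have /(congr1 (fun h => h x y)) := raddf0 (val : incidence R -> _). Qed.

End Zmod.

Section Ring.
Variable R : nzRingType.
Implicit Types f g h : incidence R.

Definition convolution (f g : X -> X -> R) (x y : X) : R :=
  \sum_(z \in [set z | (x <= z <= y)%O]) f x z * g z y.

Lemma convolutionE f g x y (E : {fset X}) :
  (forall z, (x <= z <= y)%O -> z \in E) ->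
  convolution f g x y = \sum_(z <- E) f x z * g z y.
Proof.
move=> sub; rewrite /convolution fsbig_finite; last exact: finite_interval.
apply: big_fset_incl.
  apply/fsubsetP => z; rewrite in_fset_set; last exact: finite_interval.
  by rewrite inE /=; exact: sub.
move=> z _; rewrite in_fset_set; last exact: finite_interval.
rewrite notin_setE /= => /negP; rewrite negb_and => /orP[xz|zy].
  by rewrite inc0 // mul0r.
by rewrite [g z y]inc0 // mulr0.
Qed.

Lemma convolution_subproof f g : convolution f g \in incidence_fun R.
Proof.
apply/asboolP => x y xy; rewrite (@convolutionE f g x y fset0) ?big_seq_fset0 //.
by move=> z /andP[xz zy]; rewrite (le_trans xz zy) in xy.
Qed.

Definition inc_mul f g : incidence R := Incidence (convolution_subproof f g).

Lemma inc_one_subproof : (fun x y : X => (x == y)%:R : R) \in incidence_fun R.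
Proof.
apply/asboolP => x y xy.
by case: eqP xy => [->|//]; rewrite lexx.
Qed.

Definition inc_one : incidence R := Incidence inc_one_subproof.

Definition itv_fset x y : {fset X} := fset_set [set z | (x <= z <= y)%O].

Lemma in_itv_fset x y z : (z \in itv_fset x y) = (x <= z <= y)%O.
Proof.
rewrite in_fset_set; last exact: finite_interval.
by apply/idP/idP; rewrite inE.
Qed.

Lemma inc_mul_widen f g x y (E : {fset X}) :
  (forall z, (x <= z <= y)%O -> z \in E) ->
  inc_mul f g x y = \sum_(z <- E) f x z * g z y.
Proof. exact: convolutionE. Qed.

Lemma inc_mulE f g x y :
  inc_mul f g x y = \sum_(z <- itv_fset x y) f x z * g z y.
Proof. by apply: inc_mul_widen => z; rewrite in_itv_fset. Qed.

Lemma inc_mulA : associative inc_mul.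
Proof.
move=> f g h; apply: inc_ext => x y.
have [xy|xy] := boolP (x <= y)%O; last by rewrite !inc0.
rewrite !inc_mulE.
transitivity (\sum_(z <- itv_fset x y) \sum_(w <- itv_fset x y)
    f x z * g z w * h w y).
  apply: eq_big_seq => z; rewrite in_itv_fset => /andP[xz zy].
  rewrite (@inc_mul_widen g h z y (itv_fset x y)) => [|w /andP[zw wy]].
    by rewrite mulr_sumr; apply: eq_bigr => w _; rewrite mulrA.
  by rewrite in_itv_fset (le_trans xz zw).
rewrite exchange_big; apply: eq_big_seq => w; rewrite in_itv_fset => /andP[xw wy].
rewrite (@inc_mul_widen f g x w (itv_fset x y)) => [|z /andP[xz zw]].
  by rewrite mulr_suml.
by rewrite in_itv_fset xz (le_trans zw wy).
Qed.

Lemma inc_mul1 : left_id inc_one inc_mul.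
Proof.
move=> f; apply: inc_ext => x y.
have [xy|xy] := boolP (x <= y)%O; last by rewrite !inc0.
rewrite inc_mulE (big_fsetD1 x) ?in_itv_fset ?lexx //= eqxx mul1r.
rewrite big1_seq ?addr0 // => z /=; rewrite !inE => /andP[zx _].
by rewrite eq_sym (negPf zx) mul0r.
Qed.

Lemma inc_mulr1 : right_id inc_one inc_mul.
Proof.
move=> f; apply: inc_ext => x y.
have [xy|xy] := boolP (x <= y)%O; last by rewrite !inc0.
rewrite inc_mulE (big_fsetD1 y) ?in_itv_fset ?lexx ?xy //= eqxx mulr1.
rewrite big1_seq ?addr0 // => z /=; rewrite !inE => /andP[zy _].
by rewrite (negPf zy) mulr0.
Qed.

Lemma inc_mulDl : left_distributive inc_mul +%R.
Proof.
move=> f g h; apply: inc_ext => x y; rewrite incDE !inc_mulE -big_split.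
by apply: eq_bigr => z _; rewrite incDE; exact: mulrDl.
Qed.

Lemma inc_mulDr : right_distributive inc_mul +%R.
Proof.
move=> f g h; apply: inc_ext => x y; rewrite incDE !inc_mulE -big_split.
by apply: eq_bigr => z _; rewrite incDE; exact: mulrDr.
Qed.

Lemma inc_one_neq0 : inc_one != 0.
Proof.
apply/eqP; have [x] : inhabited X by exact: lf_inhabited.
move=> /(congr1 (fun f : incidence R => f x x)).
by rewrite inc0E /= eqxx => /eqP; rewrite oner_eq0.
Qed.

HB.instance Definition _ := GRing.Zmodule_isNzRing.Build (incidence R)
  inc_mulA inc_mul1 inc_mulr1 inc_mulDl inc_mulDr inc_one_neq0.

Lemma incME f g x y :
  (f * g) x y = \sum_(z <- itv_fset x y) f x z * g z y.
Proof. exact: inc_mulE. Qed.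

Lemma inc1E x y : (1 : incidence R) x y = (x == y)%:R.
Proof. by []. Qed.

End Ring.

Section Lmod.
Variables (T : pzRingType) (R : lmodType T).

Lemma incidence_scale_closed : GRing.scaler_closed (incidence_fun R).
Proof.
move=> t f /asboolP f0; apply/asboolP => x y xy.
by rewrite !fctE f0 // scaler0.
Qed.

HB.instance Definition _ :=
  GRing.isScaleClosed.Build T (X -> X -> R) (incidence_fun R)
    incidence_scale_closed.
HB.instance Definition _ :=
  [SubZmodule_isSubLmodule of incidence R by <:].

Lemma incZE t (f : incidence R) x y : (t *: f) x y = t *: f x y.
Proof. by have /(congr1 (fun h => h x y)) := linearZZ (val : incidence R -> _) t f. Qed.

End Lmod.

Section Alg.
Variables (T : comNzRingType) (R : algType T).

Lemma inc_scaleAl (t : T) (f g : incidence R) : t *: (f * g) = (t *: f) * g.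
Proof.
apply: inc_ext => x y; rewrite incZE !incME scaler_sumr.
by apply: eq_bigr => z _; rewrite incZE; exact: scalerAl.
Qed.

Lemma inc_scaleAr (t : T) (f g : incidence R) : t *: (f * g) = f * (t *: g).
Proof.
apply: inc_ext => x y; rewrite incZE !incME scaler_sumr.
by apply: eq_bigr => z _; rewrite incZE; exact: scalerAr.
Qed.

HB.instance Definition _ :=
  GRing.Lmodule_isLalgebra.Build T (incidence R) inc_scaleAl.
HB.instance Definition _ :=
  GRing.Lalgebra_isAlgebra.Build T (incidence R) inc_scaleAr.

End Alg.

End Incidence.

Section IncidenceDerivations.
Variables (d : Order.disp_t) (X : lfPreorderType d).
Variables (T : comNzRingType) (R : algType T).
Local Notation K := (incidence X R).

Definition Lpred : {pred K} :=
  fun f => `[< forall x y, ~~ ord_equiv x y -> f x y = 0 >].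

Definition Mpred : {pred K} :=
  fun f => `[< forall x y, ord_equiv x y -> f x y = 0 >].

Lemma LpredP (f : K) :
  reflect (forall x y, ~~ ord_equiv x y -> f x y = 0) (f \in Lpred).
Proof. exact: asboolP. Qed.

Lemma MpredP (f : K) :
  reflect (forall x y, ord_equiv x y -> f x y = 0) (f \in Mpred).
Proof. exact: asboolP. Qed.

Lemma ord_equivW (x y : X) : ord_equiv x y -> (x <= y)%O.
Proof. by case/andP. Qed.

Lemma ord_equiv_interval (x y z : X) :
  ord_equiv x y -> (x <= z <= y)%O -> ord_equiv x z /\ ord_equiv z y.
Proof.
move=> /andP[xy yx] /andP[xz zy]; rewrite /ord_equiv xz zy /=.
by split; [exact: le_trans zy yx|exact: le_trans yx xz].
Qed.

Lemma ord_equiv_trans (x y z : X) :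
  ord_equiv x y -> ord_equiv y z -> ord_equiv x z.
Proof.
move=> /andP[xy yx] /andP[yz zy].
by rewrite /ord_equiv (le_trans xy yz) (le_trans zy yx).
Qed.

Lemma Lpred_closed : GRing.subsemialg_closed Lpred.
Proof.
split.
- apply/LpredP => x y xy; rewrite inc1E; case: eqP xy => [->|//].
  by rewrite /ord_equiv lexx.
- split=> [|f g /LpredP f0 /LpredP g0].
    by apply/LpredP => x y _; rewrite inc0E.
  by apply/LpredP => x y xy; rewrite incDE f0 // g0 // addr0.
- move=> t f /LpredP f0; apply/LpredP => x y xy.
  by rewrite incZE f0 // scaler0.
- move=> f g /LpredP f0 /LpredP g0; apply/LpredP => x y xy.
  rewrite incME big1 // => z _.
  have [xz|/f0->] := boolP (ord_equiv x z); last by rewrite mul0r.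
  have [zy|/g0->] := boolP (ord_equiv z y); last by rewrite mulr0.
  by rewrite (ord_equiv_trans xz zy) in xy.
Qed.

Lemma Mpred_closed : GRing.submod_closed Mpred.
Proof.
split; first by apply/MpredP => x y _; rewrite inc0E.
move=> t f g /MpredP f0 /MpredP g0; apply/MpredP => x y xy.
by rewrite incDE incZE f0 // g0 // scaler0 addr0.
Qed.

HB.instance Definition _ := GRing.isSubalgClosed.Build T K Lpred Lpred_closed.
HB.instance Definition _ := GRing.isSubmodClosed.Build T K Mpred
  (GRing.submod_closed_semi Mpred_closed).

Record incL := IncL { incL_val :> K; _ : incL_val \in Lpred }.

HB.instance Definition _ := [isSub for incL_val].
HB.instance Definition _ := [Choice of incL by <:].
HB.instance Definition _ := [SubChoice_isSubAlgebra of incL by <:].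

Record incM := IncM { incM_val :> K; _ : incM_val \in Mpred }.

HB.instance Definition _ := [isSub for incM_val].
HB.instance Definition _ := [Choice of incM by <:].
HB.instance Definition _ := [SubChoice_isSubLmodule of incM by <:].


Local Notation L := incL.
Local Notation M := incM.

Lemma Lpart_subproof1 (f : K) :
  (fun x y => if ord_equiv x y then f x y else 0) \in @incidence_fun d X R.
Proof.
apply/asboolP => x y xy; case: ifPn => // /ord_equivW.
by rewrite (negPf xy).
Qed.

Lemma Lpart_subproof2 (f : K) : Incidence (Lpart_subproof1 f) \in Lpred.
Proof. by apply/LpredP => x y /= /negPf->. Qed.

(* [Lpart] and [Mpart] are the projections given by [K = L (+) M] *)
Definition Lpart (f : K) : L := IncL (Lpart_subproof2 f).

Lemma Mpart_subproof1 (f : K) :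
  (fun x y => if ord_equiv x y then 0 else f x y) \in @incidence_fun d X R.
Proof.
apply/asboolP => x y xy; case: ifPn => // _; exact: inc0.
Qed.

Lemma Mpart_subproof2 (f : K) : Incidence (Mpart_subproof1 f) \in Mpred.
Proof. by apply/MpredP => x y /= ->. Qed.

Definition Mpart (f : K) : M := IncM (Mpart_subproof2 f).

Lemma LM_decomposition (f : K) : f = val (Lpart f) + val (Mpart f).
Proof.
by apply: inc_ext => x y; rewrite incDE /=; case: ifP; rewrite ?addr0 ?add0r.
Qed.

Lemma LpartE f x y : val (Lpart f) x y = if ord_equiv x y then f x y else 0.
Proof. by []. Qed.

Lemma MpartE f x y : val (Mpart f) x y = if ord_equiv x y then 0 else f x y.
Proof. by []. Qed.

Lemma incL_ext (a b : L) : (forall x y, a x y = b x y) -> a = b.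
Proof. by move=> ab; apply/val_inj/inc_ext. Qed.

Lemma valLP (a : L) x y : ~~ ord_equiv x y -> val a x y = 0.
Proof. by move: x y; apply/LpredP; case: a. Qed.

Lemma valL_mul (a b : L) : val (a * b) = val a * val b.
Proof. exact: (rmorphM (val : L -> K)). Qed.

Lemma valL_add (a b : L) : val (a + b) = val a + val b.
Proof. exact: (raddfD (val : L -> K)). Qed.

Lemma valL_scale t (a : L) : val (t *: a) = t *: val a.
Proof. exact: (linearZZ (val : L -> K)). Qed.

Lemma Lpart_val : cancel val Lpart.
Proof.
move=> a; apply: incL_ext => x y /=; case: ifPn => // xy.
by rewrite [RHS]valLP.
Qed.

Lemma Lpart_is_linear : linear Lpart.
Proof.
move=> t f g; apply/val_inj; rewrite valL_add valL_scale; apply: inc_ext => x y.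
rewrite incDE incZE !LpartE incDE incZE; case: ifP => // _.
by rewrite scaler0 addr0.
Qed.

HB.instance Definition _ := GRing.isLinear.Build T K L *:%R Lpart Lpart_is_linear.

Lemma LpartM f g : Lpart (f * g) = Lpart f * Lpart g.
Proof.
apply/val_inj; rewrite valL_mul; apply: inc_ext => x y.
have [xy|xy] := boolP (ord_equiv x y); last first.
  by rewrite -valL_mul !valLP.
rewrite LpartE xy !incME; apply: eq_big_seq => z.
by rewrite in_itv_fset => /(ord_equiv_interval xy)[xz zy] /=; rewrite xz zy.
Qed.

Lemma alpha_subproof (D : Der K) :
  (fun a : L => Lpart (D (val a))) \in derivation L.
Proof.
apply/asboolP; split=> [t a b|a b].
  by rewrite valL_add valL_scale !linearP.
by rewrite valL_mul derM linearD /= !LpartM !Lpart_val.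
Qed.

Definition alpha (D : Der K) : Der L := MkDer (alpha_subproof D).

Lemma alphaE (D : Der K) a : alpha D a = Lpart (D (val a)).
Proof. by []. Qed.

Definition delta (D : Der K) : L -> M := fun a => Mpart (D (val a)).

Lemma der_decomposition (D : Der K) (a : L) :
  D (val a) = val (alpha D a) + val (delta D a).
Proof. exact: LM_decomposition. Qed.

Lemma alpha_is_linear : linear alpha.
Proof.
move=> t D E; apply: der_ext => a.
by rewrite derDE derZE !alphaE derDE derZE linearP.
Qed.

HB.instance Definition _ :=
  GRing.isLinear.Build T (Der K) (Der L) *:%R alpha alpha_is_linear.

Lemma valM_add (a b : M) : val (a + b) = val a + val b.
Proof. exact: (raddfD (val : M -> K)). Qed.

Lemma valM_scale t (a : M) : val (t *: a) = t *: val a.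
Proof. exact: (linearZZ (val : M -> K)). Qed.

Lemma Mpart_is_linear : linear Mpart.
Proof.
move=> t f g; apply/val_inj; rewrite valM_add valM_scale; apply: inc_ext => x y.
rewrite incDE incZE !MpartE incDE incZE; case: ifP => // _.
by rewrite scaler0 addr0.
Qed.

HB.instance Definition _ := GRing.isLinear.Build T K M *:%R Mpart Mpart_is_linear.

Definition Omega : {pred Der L} := imagem alpha predT.

Definition Lambda : {pred Der K} := fun D => `[< forall a, delta D a = 0 >].

Definition Psi : {pred Der K} :=
  fun D => `[< (forall a, alpha D a = 0) /\ (forall a, delta D a = 0) >].

Definition In0 : {pred Der K} := imagem (@ad T K) Lpred.
Definition In1 : {pred Der K} := imagem (@ad T K) Mpred.

Definition centerL : {pred L} := fun c => `[< forall a, c * a = a * c >].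

Definition Psi0 : {pred Der K} := imagem (fun c : L => ad (val c)) centerL.

Lemma Omega_closed : GRing.submod_closed Omega.
Proof. exact: submod_closed_imagem. Qed.

HB.instance Definition _ := GRing.isSubmodClosed.Build T (Der L) Omega
  (GRing.submod_closed_semi Omega_closed).

Lemma Psi_closed : GRing.submod_closed Psi.
Proof.
split.
  apply/asboolP; split=> a; first by rewrite linear0.
  by rewrite /delta [X in Mpart X](_ : _ = 0) ?linear0.
move=> t D E /asboolP[aD dD] /asboolP[aE dE]; apply/asboolP; split=> a.
  by rewrite linearP derDE derZE aD aE scaler0 addr0.
have -> : delta (t *: D + E) a = t *: delta D a + delta E a.
  by rewrite /delta derDE derZE linearP.
by rewrite dD dE scaler0 addr0.
Qed.

HB.instance Definition _ := GRing.isSubmodClosed.Build T (Der K) Psi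
  (GRing.submod_closed_semi Psi_closed).

Lemma centerL_closed : GRing.submod_closed centerL.
Proof.
split; first by apply/asboolP => a; rewrite mul0r mulr0.
move=> t b c /asboolP bC /asboolP cC; apply/asboolP => a.
by rewrite mulrDl mulrDr -scalerAl -scalerAr bC cC.
Qed.

Lemma adL_is_linear : linear (fun c : L => ad (val c)).
Proof. by move=> t b c; rewrite valL_add valL_scale linearP. Qed.

Lemma Psi0_closed : GRing.submod_closed Psi0.
Proof.
pose f : {linear L -> Der K} := HB.pack (fun c : L => ad (val c))
  (GRing.isLinear.Build T L (Der K) *:%R (fun c : L => ad (val c)) adL_is_linear).
exact: (submod_closed_imagem f centerL_closed).
Qed.

HB.instance Definition _ := GRing.isSubmodClosed.Build T (Der K) Psi0
  (GRing.submod_closed_semi Psi0_closed).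

Lemma Psi0_sub_Psi : {subset Psi0 <= Psi}.
Proof.
move=> _ /asboolP[c /asboolP cC ->].
have ad0 (a : L) : ad (val c) (val a) = 0 by rewrite /= -!valL_mul cC subrr.
apply/asboolP; split=> a; first by rewrite alphaE ad0 linear0.
by rewrite /delta ad0 linear0.
Qed.

Section RingDerivations.
Variable eps : Der R.

Lemma entrywise_subproof (g : K) :
  (fun x y => eps (g x y)) \in @incidence_fun d X R.
Proof. by apply/asboolP => x y xy; rewrite inc0 // linear0. Qed.

Definition entrywise (g : K) : K := Incidence (entrywise_subproof g).

Lemma entrywiseE g x y : entrywise g x y = eps (g x y).
Proof. by []. Qed.

Lemma entrywise_derivation : entrywise \in derivation K.
Proof.
apply/asboolP; split=> [t f g|f g]; apply: inc_ext => x y.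
  by rewrite incDE incZE !entrywiseE incDE incZE linearP.
rewrite incDE entrywiseE !incME -big_split linear_sum.
by apply: eq_bigr => z _; exact: (derM eps).
Qed.

Definition derK_of : Der K := MkDer entrywise_derivation.

Lemma entrywiseL_subproof (a : L) : entrywise (val a) \in Lpred.
Proof. by apply/LpredP => x y xy /=; rewrite valLP // linear0. Qed.

Definition entrywiseL (a : L) : L := IncL (entrywiseL_subproof a).

Lemma entrywiseLE a : val (entrywiseL a) = derK_of (val a).
Proof. by []. Qed.

Lemma entrywiseL_derivation : entrywiseL \in derivation L.
Proof.
apply/asboolP; split=> [t a b|a b]; apply/val_inj.
  by rewrite valL_add valL_scale !entrywiseLE valL_add valL_scale linearP.
by rewrite valL_add !valL_mul !entrywiseLE valL_mul derM.
Qed.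

Definition derL_of : Der L := MkDer entrywiseL_derivation.

End RingDerivations.

Definition DK : {pred Der K} := imagem derK_of predT.
Definition DL : {pred Der L} := imagem derL_of predT.

End IncidenceDerivations.

#[global] Arguments incL {d} X {T} R.
#[global] Arguments incM {d} X {T} R.
#[global] Arguments Omega {d} X {T} R _.
#[global] Arguments Lambda {d} X {T} R _.
#[global] Arguments Psi {d} X {T} R _.
#[global] Arguments Psi0 {d} X {T} R _.
#[global] Arguments In0 {d} X {T} R _.
#[global] Arguments In1 {d} X {T} R _.
#[global] Arguments DK {d} X {T} R _.
#[global] Arguments DL {d} X {T} R _.

(* Main.v *)
(* A derivation D of K is determined entrywise once it kills the
   diagonal idempotents e_x, which can be arranged by subtracting ad c with
   c(x, y) = D(e_x)(x, y). Writing an entry r at (x, y) as that of (r 1) zeta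
   or of zeta (r 1), with zeta the characteristic function of the order, gives
   D f (x, y) = D_x(f(x, y)) + f(x, y) tau(x, y)
              = tau(x, y) f(x, y) + D_y(f(x, y)),
   where tau = D(zeta) and D_x is a derivation of R. So D_y - D_x is inner for
   x <= y, and by connectedness all D_x agree up to a diagonal inner derivation;
   subtracting it and one entrywise derivation leaves D f = f tau entrywise with
   tau an additive cocycle commuting with R. On each equivalence class tau is a
   coboundary s(y) - s(x), so subtracting ad (diag s) leaves an element of Psi.
   Both isomorphisms then come from two linear surjections with equal kernels. *)
Require Import Defs.
From HB Require Import structures.
From mathcomp Require Import all_boot all_order all_algebra finmap.
From mathcomp Require Import boolp classical_sets functions.

Set Implicit Arguments.
Unset Strict Implicit.
Unset Printing Implicit Defensive.

Import Order.TTheory GRing.Theory.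
Local Open Scope ring_scope.

(** * Diagonal elements, diagonal idempotents and zeta *)

Section DiagonalElements.
Variables (d : Order.disp_t) (X : lfPreorderType d) (R : nzRingType).
Implicit Types (f g : incidence X R) (q : X -> R) (x y : X).

Lemma inc_diag_subproof q :
  (fun x y : X => if x == y then q x else 0) \in @incidence_fun d X R.
Proof.
by apply/asboolP => x y xy; case: eqP xy => // ->; rewrite lexx.
Qed.

Definition inc_diag q : incidence X R := Incidence (inc_diag_subproof q).

Lemma inc_diagE q x y : inc_diag q x y = if x == y then q x else 0.
Proof. by []. Qed.

Lemma mul_diag_inc q f x y : (inc_diag q * f) x y = q x * f x y.
Proof.
have [xy|xy] := boolP (x <= y)%O; last by rewrite !inc0 ?mulr0.
rewrite incME (big_fsetD1 x) ?in_itv_fset ?lexx //= eqxx.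
rewrite big1_seq ?addr0 // => z /=; rewrite !inE => /andP[zx _].
by rewrite eq_sym (negPf zx) mul0r.
Qed.

Lemma mul_inc_diag f q x y : (f * inc_diag q) x y = f x y * q y.
Proof.
have [xy|xy] := boolP (x <= y)%O; last by rewrite !inc0 ?mul0r.
rewrite incME (big_fsetD1 y) ?in_itv_fset ?lexx ?xy //= eqxx.
rewrite big1_seq ?addr0 // => z /=; rewrite !inE => /andP[zy _].
by rewrite (negPf zy) mulr0.
Qed.

Definition inc_idem x : incidence X R := inc_diag (fun z => (z == x)%:R).

Lemma mul_idem_inc x f u v : (inc_idem x * f) u v = if u == x then f u v else 0.
Proof. by rewrite mul_diag_inc; case: eqP; rewrite ?mul1r ?mul0r. Qed.

Lemma mul_inc_idem f x u v : (f * inc_idem x) u v = if v == x then f u v else 0.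
Proof. by rewrite mul_inc_diag; case: eqP; rewrite ?mulr1 ?mulr0. Qed.

Lemma inc_idemM x y : inc_idem x * inc_idem y = if x == y then inc_idem x else 0.
Proof.
apply: inc_ext => u v; rewrite mul_inc_idem.
case: (eqVneq x y) => [<-|xy]; rewrite ?inc0E !inc_diagE.
  by case: (eqVneq v x) => // vx; case: eqP => // ->; rewrite (negPf vx).
case: (eqVneq v y) => // ->; case: eqP => // ->.
by rewrite eq_sym (negPf xy).
Qed.

Lemma inc_zeta_subproof :
  (fun x y : X => (x <= y)%O%:R : R) \in @incidence_fun d X R.
Proof. by apply/asboolP => x y /negPf ->. Qed.

Definition inc_zeta : incidence X R := Incidence inc_zeta_subproof.

Lemma inc_mul_zeta f x y : f x y * inc_zeta x y = f x y.
Proof.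
by rewrite /=; case: (boolP (x <= y)%O) => xy; rewrite ?mulr1 // inc0 ?mul0r.
Qed.

Lemma inc_zeta_mul f x y : inc_zeta x y * f x y = f x y.
Proof.
by rewrite /=; case: (boolP (x <= y)%O) => xy; rewrite ?mul1r // inc0 ?mulr0.
Qed.

End DiagonalElements.

(** * Quotient maps and a criterion for isomorphism *)

Section Quotients.
Variable T : pzRingType.
Implicit Types U V W : lmodType T.

Definition quotm_pi V (N : submodClosed V) (v : V) : quotm N :=
  (\pi_(Quotient.quot (zmod_pred N)) v)%qT.

Lemma quotm_pi_linear V (N : submodClosed V) : linear (quotm_pi N).
Proof. by move=> t u v; rewrite /quotm_pi pi_addq -pi_scaleq. Qed.

Lemma quotm_pi_surj V (N : submodClosed V) x : exists v, quotm_pi N v = x.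
Proof. by elim/quotmW: x => v; exists v. Qed.

Lemma quotm_pi_eq0 V (N : submodClosed V) v : quotm_pi N v = 0 <-> v \in N.
Proof.
have pi0 : quotm_pi N 0 = 0.
  have := quotm_pi_linear N 1 0 0; rewrite scaler0 addr0 scale1r.
  by move/(congr1 (fun z => z - quotm_pi N 0)); rewrite subrr addrK => <-.
have -> : (v \in N) = (v - 0 \in zmod_pred N) by rewrite subr0.
rewrite Quotient.idealrBE -pi0; split=> [/eqP|/eqP]; exact.
Qed.

Lemma quotm_pi_eq V (N : submodClosed V) u v :
  u - v \in N -> quotm_pi N u = quotm_pi N v.
Proof.
move=> /quotm_pi_eq0 e0; rewrite -[u](subrK v).
by have := quotm_pi_linear N 1 (u - v) v; rewrite !scale1r e0 add0r.
Qed.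

Lemma in_inside V (S N : submodClosed V) (v : subm S) :
  (v \in inside S N) = (val v \in N).
Proof. by []. Qed.

(** Equal kernels make the correspondence from [f w] to [g w] well defined and injective. Sections
    of [f] and [g], picked by choice, realise it and its inverse. *)
Lemma lmod_iso_surj U V W (f : W -> U) (g : W -> V) :
  linear f -> linear g ->
  (forall u, exists w, f w = u) -> (forall v, exists w, g w = v) ->
  (forall w, f w = 0 <-> g w = 0) -> lmod_iso U V.
Proof.
move=> fL gL /choice[s sK] /choice[r rK] fg.
have linB (V' : lmodType T) (h : W -> V') : linear h ->
    forall a b, h (a - b) = h a - h b.
  by move=> hL a b; rewrite addrC -scaleN1r hL scaleN1r addrC.
have eqfg a b : f a = f b <-> g a = g b.
  split=> e; apply/eqP; rewrite -subr_eq0 -linB //; apply/eqP/fg.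
    by rewrite linB // e subrr.
  by rewrite linB // e subrr.
have hL : linear (g \o s).
  by move=> t u v /=; rewrite -gL; apply/eqfg; rewrite fL !sK.
pose h : {linear U -> V} := HB.pack (g \o s)
  (GRing.isLinear.Build T U V *:%R (g \o s) hL).
exists h; exists (f \o r) => [u|v] /=.
  by rewrite -[RHS]sK; apply/eqfg; rewrite rK.
by rewrite -[RHS]rK; apply/eqfg; rewrite sK.
Qed.

End Quotients.

(** * Entry formulas and normalisation on the idempotents *)

Section DerivationsOfIncidenceAlgebras.
Variables (d : Order.disp_t) (X : lfPreorderType d).
Variables (T : comNzRingType) (R : algType T).
Local Notation K := (incidence X R).
Local Notation L := (incL X R).
Local Notation e_ := (@inc_idem d X R).
Implicit Types (D : Der K) (f g : K) (x y z : X).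

Lemma adE (A : algType T) (c a : A) : ad c a = a * c - c * a.
Proof. by []. Qed.

Lemma derBE (A : algType T) (D E : Der A) a : (D - E) a = D a - E a.
Proof. by rewrite derDE -[- E]scaleN1r derZE scaleN1r. Qed.

Lemma der0E (A : algType T) a : (0 : Der A) a = 0.
Proof. by rewrite -(subrr (0 : Der A)) derBE subrr. Qed.

Lemma incBE f g x y : (f - g) x y = f x y - g x y.
Proof. by rewrite incDE -[- g](scaleN1r (V := K)) incZE scaleN1r. Qed.

Lemma derK_ofE (eps : Der R) f x y : derK_of X eps f x y = eps (f x y).
Proof. by []. Qed.

Lemma ad_idemE (c : K) x u v :
  ad c (e_ x) u v = (if u == x then c u v else 0) - (if v == x then c u v else 0).
Proof. by rewrite adE incBE mul_idem_inc mul_inc_idem. Qed.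

Lemma ad_diagE (q : X -> R) f x y :
  ad (inc_diag q) f x y = f x y * q y - q x * f x y.
Proof. by rewrite adE incBE mul_diag_inc mul_inc_diag. Qed.

Lemma der1 (A : algType T) (D : Der A) : D 1 = 0.
Proof.
have := derM D 1 1; rewrite !mulr1 mul1r => /esym/eqP.
by rewrite -subr_eq0 addrK => /eqP.
Qed.

(** Differentiating [e_ u * e_ x = 0] for u != x gives D(e_x)(u, x) = - D(e_u)(u, x), and
    differentiating [e_ x * e_ x = e_ x] kills the entries of [D (e_ x)] whose indices are both x or
    both different from x. The remaining entries are those of [ad c]. *)
Lemma der_idem_sub_inner D : exists c : K, forall x, (D - ad c) (e_ x) = 0.
Proof.
have cP : (fun x y => D (e_ x) x y) \in @incidence_fun d X R.
  by apply/asboolP => x y; exact: inc0.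
exists (Incidence cP) => x; apply: inc_ext => u v.
rewrite inc0E derBE incBE ad_idemE /=.
have ortho z : D (e_ z) * e_ x + e_ z * D (e_ x) =
    if z == x then D (e_ x) else 0.
  by rewrite -derM inc_idemM; case: eqP => [->//|_]; rewrite linear0.
have orthoE z : (if v == x then D (e_ z) u v else 0)
    + (if u == z then D (e_ x) u v else 0) = if z == x then D (e_ x) u v else 0.
  have := congr1 (fun h : K => h u v) (ortho z).
  rewrite incDE mul_inc_idem mul_idem_inc => ->.
  by case: eqP => // _; rewrite inc0E.
have := orthoE x; have := orthoE u; rewrite !eqxx.
case: (eqVneq u x) => [->|ux]; case: (eqVneq v x) => [->|vx] //=.
- by rewrite subrr subr0 => _ /eqP; rewrite -subr_eq0 addrK => /eqP.
- by rewrite subr0 subrr.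
- by rewrite sub0r opprK addrC.
- by rewrite add0r subrr subr0 => ->.
Qed.

(** * Derivations that vanish on the diagonal idempotents *)

Section VanishingOnIdempotents.
Variable D : Der K.
Hypothesis D0 : forall x, D (e_ x) = 0.

Lemma der_idemMl x f : D (e_ x * f) = e_ x * D f.
Proof. by rewrite derM D0 mul0r add0r. Qed.

Lemma der_idemMr x f : D (f * e_ x) = D f * e_ x.
Proof. by rewrite derM D0 mulr0 addr0. Qed.

(** Multiplication by [e_ x] and [e_ y] passes through [D], so the entry of [D f] at (x, y) is that
    of [D (e_ x * f * e_ y)], whose argument retains only f(x, y). *)
Lemma der_local f g x y : f x y = g x y -> D f x y = D g x y.
Proof.
move=> fg.
have Dxy h : D h x y = D (e_ x * h * e_ y) x y.
  by rewrite der_idemMr der_idemMl mul_inc_idem mul_idem_inc !eqxx.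
rewrite Dxy [RHS]Dxy; congr (D _ x y); apply: inc_ext => u v.
rewrite !mul_inc_idem !mul_idem_inc.
by case: eqP => // ->; case: eqP => // ->.
Qed.

Lemma der_diag_offdiag q x y : x != y -> D (inc_diag q) x y = 0.
Proof.
move=> xy; rewrite (@der_local _ 0) ?linear0 ?inc0E //.
by rewrite inc_diagE (negPf xy).
Qed.

Definition der_coef x (r : R) : R := D (inc_diag (fun=> r)) x x.

(** At (x, x), locality lets the diagonal element of [t *: a + b] or [a * b] be replaced by the
    combination or product of those of [a] and [b]. *)
Lemma der_coef_derivation x : der_coef x \in derivation R.
Proof.
apply/asboolP; split=> [t a b|a b]; rewrite /der_coef.
  rewrite -incZE -incDE -linearP; apply: der_local.
  by rewrite incDE incZE !inc_diagE eqxx.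
rewrite -(mul_inc_diag (D _) (fun=> b)) -(mul_diag_inc (fun=> a)) -incDE -derM.
by apply: der_local; rewrite mul_diag_inc !inc_diagE eqxx.
Qed.

Definition der_coefD x : Der R := MkDer (der_coef_derivation x).

Local Notation tau := (D (inc_zeta X R)).

(* By locality [f] can be replaced with [r * zeta], where [r = f x y]. *)
Lemma der_entryl f x y : D f x y = der_coefD x (f x y) + f x y * tau x y.
Proof.
rewrite (@der_local _ (inc_diag (fun=> f x y) * inc_zeta X R)); last first.
  by rewrite mul_diag_inc inc_mul_zeta.
rewrite derM incDE mul_diag_inc; congr (_ + _).
have [xy|xy] := boolP (x <= y)%O; last first.
  by rewrite [LHS]inc0 // inc0 // linear0.
rewrite incME (big_fsetD1 x) ?in_itv_fset ?lexx //= xy mulr1.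
rewrite big1_seq ?addr0 // => z /=; rewrite !inE => /andP[zx _].
by rewrite der_diag_offdiag ?mul0r // eq_sym.
Qed.

Lemma der_entryr f x y : D f x y = tau x y * f x y + der_coefD y (f x y).
Proof.
rewrite (@der_local _ (inc_zeta X R * inc_diag (fun=> f x y))); last first.
  by rewrite mul_inc_diag inc_zeta_mul.
rewrite derM incDE mul_inc_diag; congr (_ + _).
have [xy|xy] := boolP (x <= y)%O; last first.
  by rewrite [LHS]inc0 // [in RHS]inc0 // linear0.
(* [D] of a diagonal element vanishes off the diagonal, so only the term z = y survives. *)
rewrite incME (big_fsetD1 y) ?in_itv_fset ?lexx ?xy //= xy mul1r.
rewrite big1_seq ?addr0 // => z /=; rewrite !inE => /andP[zy _].
by rewrite der_diag_offdiag ?mulr0.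
Qed.

(** The left and right entry formulas for an element with entry r at (x, y) give D_x(r) + r tau(x,
    y) = tau(x, y) r + D_y(r). *)
Lemma der_coef_sub_inner x y : (x <= y)%O ->
  der_coefD y - der_coefD x = ad (tau x y).
Proof.
move=> xy; apply: der_ext => r; rewrite derBE adE.
pose f : K := inc_diag (fun=> r) * inc_zeta X R.
have fE : f x y = r by rewrite mul_diag_inc /= xy mulr1.
have := der_entryl f x y; rewrite der_entryr fE => E.
apply/eqP; rewrite subr_eq addrAC eq_sym subr_eq.
by rewrite [r * _ + _]addrC -E addrC.
Qed.

(** Induction along a chain of comparable elements: inner differences add up, and a step down
    contributes the negated defining element. *)
Lemma der_coef_connected x y : connected_preorder X ->
  exists q, der_coefD y - der_coefD x = ad q.
Proof.
move=> /(_ x y)[s []]; elim: s x => [|z s IH] x /=.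
  by move=> _ <-; exists 0; rewrite subrr linear0.
case/andP=> xz /IH{}IH /IH[q qE].
have [q' q'E] : exists q', der_coefD z - der_coefD x = ad q'.
  case/orP: xz => [/der_coef_sub_inner->|/der_coef_sub_inner zx].
    by eexists.
  by exists (- tau z x); rewrite linearN /= -zx opprB.
by exists (q + q'); rewrite linearD /= -qE -q'E addrA subrK.
Qed.

Hypothesis coef0 : forall x, der_coefD x = 0.

Lemma der_entry f x y : D f x y = f x y * tau x y.
Proof. by rewrite der_entryl coef0 add0r. Qed.

Lemma tau_comm x y r : r * tau x y = tau x y * r.
Proof.
have [xy|xy] := boolP (x <= y)%O; last by rewrite inc0 // mulr0 mul0r.
have := der_coef_sub_inner xy; rewrite !coef0 subrr => ad0.
by apply/eqP; rewrite -subr_eq0 -adE -ad0 der0E.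
Qed.

(** Differentiate zeta e_y zeta, whose entry at (x, z) is 1; the middle term drops because
    [D (e_ y) = 0]. *)
Lemma tau_cocycle x y z : (x <= y)%O -> (y <= z)%O ->
  tau x z = tau x y + tau y z.
Proof.
move=> xy yz; have xz := le_trans xy yz.
pose f : K := inc_zeta X R * e_ y.
have prodE (g h : K) : (g * e_ y * h) x z = g x y * h y z.
  rewrite incME (big_fsetD1 y) ?in_itv_fset ?xy // mul_inc_idem eqxx.
  rewrite big1_seq => [|w /andP[_]]; first exact: addr0.
  rewrite !inE => /andP[wy _].
  by rewrite mul_inc_idem (negPf wy) mul0r.
have := der_entry (f * inc_zeta X R) x z.
rewrite derM der_idemMr incDE -mulrA !prodE mulrA prodE /= xy yz.
by rewrite !mulr1 !mul1r => <-.
Qed.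

Lemma der_sub_inner_Psi : exists s : X -> R, D - ad (inc_diag s) \in Psi X R.
Proof.
(* [choose] does not depend on its starting witness and sees the predicate only through its
   extension, so equivalent elements share a representative. It is the base point from which tau is
   integrated on the class. *)
pose rep x := choose (ord_equiv x) x.
have equivxx x : ord_equiv x x by rewrite /ord_equiv lexx.
have repP x : ord_equiv x (rep x) by exact: chooseP.
have rep_eq x y : ord_equiv x y -> rep x = rep y.
  move=> xy; have yx : ord_equiv y x by rewrite /ord_equiv andbC.
  rewrite /rep (@eq_choose _ (ord_equiv x) (ord_equiv y)).
    exact: choose_id.
  by move=> z; apply/idP/idP; exact: ord_equiv_trans.
exists (fun x => tau (rep x) x).
suff vanish (a : L) : (D - ad (inc_diag (fun x => tau (rep x) x))) (val a) = 0.
  by apply/asboolP; split=> a; rewrite ?alphaE /delta vanish linear0.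
apply: inc_ext => x y; rewrite derBE incBE ad_diagE der_entry inc0E.
have [xy|xy] := boolP (ord_equiv x y); last first.
  by rewrite !valLP // !(mul0r, mulr0) !subr0.
(* As [rep x = rep y], the cocycle identity along rep y <= x <= y makes tau(x, y) the difference of
   the two values of the potential. *)
rewrite -tau_comm -!mulrBr (rep_eq _ _ xy) (@tau_cocycle (rep y) x y).
- by rewrite addrAC subrr add0r subrr mulr0.
- by rewrite -(rep_eq _ _ xy); case/andP: (repP x).
- by case/andP: xy.
Qed.

End VanishingOnIdempotents.

(** * Decomposition of an arbitrary derivation *)

Lemma derK_of_idem eps x : derK_of X eps (e_ x) = 0 :> K.
Proof.
apply: inc_ext => u v; rewrite derK_ofE inc_diagE inc0E.
by case: ifP => _; [case: (u == x); rewrite ?der1 ?linear0|rewrite linear0].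
Qed.

Lemma der_decomposition_inner (connX : connected_preorder X) D :
  exists c psi eps, psi \in Psi X R /\ D = ad c + (psi + derK_of X eps).
Proof.
have [c D10] := der_idem_sub_inner D.
have [D1 D1E] : exists D1, D1 = D - ad c by eexists.
rewrite -D1E in D10.
have [x0] : inhabited X by exact: lf_inhabited.
(* An arbitrary base point [x0] fixes the entrywise part; [q x] defines the inner derivation by
   which D_x deviates from D_x0. *)
have [q qE] := choice (fun x => der_coef_connected D10 x0 x connX).
pose eps := der_coefD D10 x0.
pose D2 := D1 - derK_of X eps - ad (inc_diag q).
(* Derivations of R kill the entries 0 and 1, and diagonal elements commute with [e_ x]. *)
have D20 x : D2 (e_ x) = 0.
  rewrite !derBE D10 derK_of_idem subr0 sub0r; apply/eqP; rewrite oppr_eq0.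
  apply/eqP/inc_ext => u v; rewrite ad_diagE inc_diagE inc0E.
  case: eqP => [->|_]; last by rewrite mul0r mulr0 subr0.
  by case: (v == x); rewrite ?(mul1r, mulr1, mul0r, mulr0) subrr.
(* At (x, x), [ad (inc_diag q)] acts as [ad (q x)], which is exactly D_x - D_x0. *)
have coef0 x : der_coefD D20 x = 0.
  apply: der_ext => r; rewrite [LHS]/= /der_coef !derBE incBE.
  rewrite ad_diagE incBE derK_ofE inc_diagE eqxx -[D1 _ x x]/(der_coefD D10 x r).
  by rewrite -derBE qE adE subrr der0E.
have [s Psis] := der_sub_inner_Psi coef0.
exists (c + inc_diag q + inc_diag s), (D2 - ad (inc_diag s)), eps; split=> //.
have -> : D = D1 + ad c by rewrite D1E subrK.
rewrite /D2 !linearD /= [D1 - _ - _ - _ + _]addrAC [D1 - _ - _ + _]addrAC subrK.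
rewrite -[ad c + _ + _]addrA -[D1 - _ - _]addrA -opprD addrACA subrr addr0.
exact: addrC.
Qed.

(** * Images under [alpha] and the passage between R, L and K *)

Lemma alpha_ad (c : K) : alpha (ad c) = ad (Lpart c).
Proof. by apply: der_ext => a; rewrite alphaE !adE linearB /= !LpartM Lpart_val. Qed.

Lemma alpha_derK_of (eps : Der R) : alpha (derK_of X eps) = derL_of X eps.
Proof. by apply: der_ext => a; rewrite alphaE -entrywiseLE Lpart_val. Qed.

Lemma alpha_Psi D : D \in Psi X R -> alpha D = 0.
Proof. by move/asboolP=> [aD _]; apply: der_ext => a; rewrite aD der0E. Qed.

Lemma alpha_decomposition (c : K) psi eps : psi \in Psi X R ->
  alpha (ad c + (psi + derK_of X eps)) = ad (Lpart c) + derL_of X eps.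
Proof.
by move=> Ppsi; rewrite !linearD /= (alpha_Psi Ppsi) add0r alpha_ad alpha_derK_of.
Qed.

Lemma derK_of_linear : linear (@derK_of d X T R).
Proof.
move=> t a b; apply: der_ext => f; apply: inc_ext => x y.
by rewrite derDE derZE incDE incZE !derK_ofE derDE derZE.
Qed.

Lemma derL_of_linear : linear (@derL_of d X T R).
Proof. by move=> t a b; rewrite -!alpha_derK_of derK_of_linear linearP. Qed.

Lemma derK_of_ad (r : R) : derK_of X (ad r) = ad (inc_diag (fun=> r)) :> Der K.
Proof.
by apply: der_ext => f; apply: inc_ext => x y; rewrite derK_ofE ad_diagE adE.
Qed.

Lemma derL_of_ad (r : R) : derL_of X (ad r) = ad (Lpart (inc_diag (fun=> r))).
Proof. by rewrite -alpha_derK_of derK_of_ad alpha_ad. Qed.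

Lemma inc_diag_L q : inc_diag q \in @Lpred d X T R.
Proof.
apply/LpredP => x y xy; rewrite inc_diagE; case: eqP xy => // ->.
by rewrite /ord_equiv lexx.
Qed.

Lemma val_Lpart f : f \in @Lpred d X T R -> val (Lpart f) = f.
Proof. by move=> fL; rewrite -[f]/(val (IncL fL)) Lpart_val. Qed.

Lemma val_adL (c a : L) : val (ad c a) = ad (val c) (val a).
Proof. by rewrite !adE -!valL_mul -raddfB. Qed.

(** Testing [ad c] on constant diagonal elements at one point x shows that the entry c(x, x) already
    defines [eps]. Conversely, the defining element of R lifts to a constant diagonal element. *)
Lemma derL_of_inner eps : derL_of X eps \in inner L <-> eps \in inner R.
Proof.
split=> /asboolP[c _ cE]; apply/asboolP; last first.
  by exists (Lpart (inc_diag (fun=> c))); rewrite // cE derL_of_ad.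
have [x] : inhabited X by exact: lf_inhabited.
exists (val c x x) => //; apply: der_ext => r.
have := congr1 (fun D : Der L => val (D (Lpart (inc_diag (fun=> r)))) x x) cE.
rewrite val_adL entrywiseLE val_Lpart ?inc_diag_L // derK_ofE inc_diagE eqxx.
by rewrite adE incBE mul_diag_inc mul_inc_diag.
Qed.

(** * Membership in Lambda and inner sums of Psi and D_K *)

Lemma LambdaP D : reflect (forall a, delta D a = 0) (D \in Lambda X R).
Proof. exact: asboolP. Qed.

Lemma Lambda_closed : GRing.submod_closed (Lambda X R).
Proof.
split=> [|t D E /LambdaP dD /LambdaP dE]; apply/LambdaP => a.
  by rewrite /delta der0E linear0.
by rewrite /delta derDE derZE linearP /= -!/(delta _ _) dD dE scaler0 addr0.
Qed.

Lemma LambdaD D E : D \in Lambda X R -> E \in Lambda X R -> D + E \in Lambda X R.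
Proof. by move=> DL EL; rewrite -[D]scale1r; exact: (Lambda_closed.2 1). Qed.

Lemma Psi_sub_Lambda D : D \in Psi X R -> D \in Lambda X R.
Proof. by move/asboolP=> [_ dD]; apply/LambdaP. Qed.

Lemma derK_of_Lambda eps : derK_of X eps \in Lambda X R.
Proof.
apply/LambdaP => a; apply/val_inj/inc_ext => x y.
rewrite MpartE -entrywiseLE; case: ifPn => [_|xy]; first by rewrite inc0E.
by rewrite valLP // inc0E.
Qed.

(** At inequivalent x and y, the entry of [ad c (e_ x)] is c(x, y), and [delta] sees it. Conversely,
    L is closed under commutators. *)
Lemma ad_Lambda (c : K) : ad c \in Lambda X R <-> c \in @Lpred d X T R.
Proof.
split=> [/LambdaP dc|cL]; last first.
  apply/LambdaP => a; apply/val_inj/inc_ext => x y.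
  rewrite MpartE -[c](val_Lpart cL) -val_adL.
  by case: ifPn => [_|xy]; rewrite ?inc0E // valLP.
apply/LpredP => x y xy.
have := congr1 (fun b : incM X R => val b x y) (dc (Lpart (e_ x))).
rewrite MpartE (negPf xy) val_Lpart ?inc_diag_L // ad_idemE eqxx.
case: eqP xy => [->|_ _]; first by rewrite /ord_equiv lexx.
by rewrite subr0 => ->; rewrite inc0E.
Qed.

Lemma Lpred_Mpred_eq0 f : f \in @Lpred d X T R -> f \in @Mpred d X T R -> f = 0.
Proof.
move=> /LpredP fL /MpredP fM; apply: inc_ext => x y; rewrite inc0E.
by have [/fM|/fL] := boolP (ord_equiv x y).
Qed.

Lemma inner_ad (A : algType T) (c : A) : ad c \in inner A.
Proof. by apply/asboolP; exists c. Qed.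

Lemma addm_Psi_DK psi eps :
  psi \in Psi X R -> psi + derK_of X eps \in addm (Psi X R) (DK X R).
Proof.
move=> Ppsi; apply/asboolP; exists psi, (derK_of X eps); split=> //.
by apply/asboolP; exists eps.
Qed.

Lemma addm_Psi_DK_sub_Lambda :
  {subset addm (In0 X R) (addm (Psi X R) (DK X R)) <= Lambda X R}.
Proof.
move=> _ /asboolP[_ [E [/asboolP[c cL ->] EP ->]]].
move: EP => /asboolP[psi [_ [Ppsi /asboolP[eps _ ->] ->]]].
apply: LambdaD; first exact/ad_Lambda.
by rewrite LambdaD ?derK_of_Lambda ?Psi_sub_Lambda.
Qed.

(** This is the kernel of the map to Out K. If the sum is [ad c], then c lies in L since the sum is
    in Lambda. As [alpha] forgets [psi], the restriction of [eps] to L is inner, hence [eps = ad r].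
    Then c minus the diagonal of r defines [psi] and is central in L because [alpha psi = 0]. *)
Lemma Psi_derK_of_inner psi eps : psi \in Psi X R ->
  psi + derK_of X eps \in inner K <-> psi \in Psi0 X R /\ eps \in inner R.
Proof.
move=> Ppsi; split; last first.
  move=> [/asboolP[c _ ->] /asboolP[r _ ->]].
  by rewrite derK_of_ad -linearD; exact: inner_ad.
move=> /asboolP[c _ cE].
have cL : c \in @Lpred d X T R.
  by apply/ad_Lambda; rewrite -cE LambdaD ?derK_of_Lambda ?Psi_sub_Lambda.
have /asboolP[r _ rE] : eps \in inner R.
  apply/derL_of_inner; rewrite -alpha_derK_of -[alpha _]add0r -(alpha_Psi Ppsi).
  by rewrite -linearD cE /= alpha_ad inner_ad.
split; last by rewrite rE inner_ad.
pose b : L := Lpart (c - inc_diag (fun=> r)).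
have bE : psi = ad (val b).
  rewrite val_Lpart; last by rewrite rpredB ?inc_diag_L.
  by rewrite linearB /= -cE rE derK_of_ad addrK.
apply/asboolP; exists b => //; apply/asboolP => a.
apply/esym/eqP; rewrite -subr_eq0 -adE -[b]Lpart_val -alpha_ad -bE.
by rewrite alpha_Psi ?der0E.
Qed.

End DerivationsOfIncidenceAlgebras.

(** * Sums, intersections and quotients of the modules of derivations *)

Theorem theorem17p7 (d : Order.disp_t) (X : lfPreorderType d)
    (T : comNzRingType) (R : algType T) (connX : connected_preorder X) :
  [/\ Omega X R =i addm (DL X R) (inner (incL X R)),
      lmod_iso (subquot (Omega X R) (inner (incL X R))) (Out R),
      [/\ independent (Psi X R) (DK X R),
          Lambda X R =i addm (In0 X R) (addm (Psi X R) (DK X R)),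
          predT =i addm (inner (incidence X R)) (addm (Psi X R) (DK X R)),
          independent (In1 X R)
                      (addm (In0 X R) (addm (Psi X R) (DK X R)))
        & predT =i addm (In1 X R)
                        (addm (In0 X R) (addm (Psi X R) (DK X R)))]
    & lmod_iso (Out (incidence X R)) (subquot (Psi X R) (Psi0 X R) * Out R)%type].
Proof.
pose dec := der_decomposition_inner connX.
have LambdaE : Lambda X R =i addm (In0 X R) (addm (Psi X R) (DK X R)).
  move=> D; apply/idP/idP; last exact: addm_Psi_DK_sub_Lambda.
  move=> DLam; have [c [psi [eps [Ppsi DE]]]] := dec _ R D.
  apply/asboolP; exists (ad c), (psi + derK_of X eps); split=> //.
    (* [ad c] is a difference of two members of Lambda, which forces c into L. *)
    apply/asboolP; exists c => //; apply/ad_Lambda.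
    have -> : ad c = D + -1 *: (psi + derK_of X eps).
      by rewrite DE scaleN1r addrK.
    apply: LambdaD => //; rewrite -[_ *: _]addr0.
    apply: (Lambda_closed _ _).2; last exact: (Lambda_closed _ _).1.
    by rewrite LambdaD ?derK_of_Lambda ?Psi_sub_Lambda.
  exact: addm_Psi_DK.
split.
- move=> D; apply/idP/idP => /asboolP.
    move=> [E _ ->]; have [c [psi [eps [Ppsi ->]]]] := dec _ _ E.
    rewrite alpha_decomposition // addrC.
    apply/asboolP; exists (derL_of X eps), (ad (Lpart c)).
    by split; rewrite ?inner_ad //; apply/asboolP; exists eps.
  move=> [_ [_ [/asboolP[eps _ ->] /asboolP[c _ ->] ->]]]; apply/asboolP.
  exists (derK_of X eps + ad (val c)) => //.
  by rewrite linearD /= alpha_derK_of alpha_ad Lpart_val.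
- have OmegaL eps : derL_of X eps \in Omega X R.
    by apply/asboolP; exists (derK_of X eps); rewrite // alpha_derK_of.
  (* [Der R] maps onto both quotients, with equal kernels by [derL_of_inner]; modulo inner
     derivations of L, [alpha] sees only the entrywise part. *)
  pose f eps := quotm_pi (inside (Omega X R) (inner (incL X R))) (Subm (OmegaL eps)).
  apply: (@lmod_iso_surj _ _ _ (Der R) f (quotm_pi (inner R))).
  + move=> t a b; rewrite /f -quotm_pi_linear; congr (quotm_pi _ _).
    by apply/val_inj; rewrite /= derL_of_linear.
  + exact: quotm_pi_linear.
  + move=> u; have [[D OD] <-] := quotm_pi_surj u.
    have /asboolP[E _ DE] := OD; have [c [psi [eps [Ppsi EE]]]] := dec _ _ E.
    exists eps; apply: quotm_pi_eq; rewrite in_inside raddfB /= DE EE.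
    rewrite alpha_decomposition // opprD addrCA subrr addr0.
    by rewrite -linearN /= inner_ad.
  + exact: quotm_pi_surj.
  + move=> eps; split=> [/quotm_pi_eq0|/quotm_pi_eq0 ?].
      by rewrite in_inside => /derL_of_inner/quotm_pi_eq0.
    by apply/quotm_pi_eq0; rewrite in_inside; apply/derL_of_inner.
- split.
  (* A member of Psi kills L, in particular the constant diagonal element of value f(x, y); the
     entry at (x, x) then gives eps(f(x, y)) = 0. *)
  + move=> D /asboolP[aD dD] /asboolP[eps _ DE]; apply: der_ext => f.
    apply: inc_ext => x y; rewrite der0E inc0E DE derK_ofE.
    have := der_decomposition D (Lpart (inc_diag (fun=> f x y))).
    rewrite aD dD !raddf0 addr0 val_Lpart ?inc_diag_L // DE.
    by move=> /(congr1 (fun g : incidence X R => g x x));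
      rewrite derK_ofE inc_diagE eqxx inc0E.
  + exact: LambdaE.
  + move=> D; apply/esym/asboolP; have [c [psi [eps [Ppsi ->]]]] := dec _ _ D.
    exists (ad c), (psi + derK_of X eps).
    by split; rewrite ?inner_ad ?addm_Psi_DK.
  (* The second summand lies in Lambda, so c belongs to both L and M. *)
  + move=> _ /asboolP[c cM ->] /addm_Psi_DK_sub_Lambda/ad_Lambda cL.
    by rewrite (Lpred_Mpred_eq0 cL cM) linear0.
  + move=> D; apply/esym/asboolP; have [c [psi [eps [Ppsi ->]]]] := dec _ _ D.
    exists (ad (val (Mpart c))), (ad (val (Lpart c)) + (psi + derK_of X eps)).
    split.
    * by apply/asboolP; exists (val (Mpart c)) => //; exact: valP.
    * apply/asboolP; exists (ad (val (Lpart c))), (psi + derK_of X eps).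
      split; rewrite ?addm_Psi_DK //; apply/asboolP.
      by exists (val (Lpart c)) => //; exact: valP.
    * by rewrite [RHS]addrA [ad _ + ad _]addrC -linearD -LM_decomposition.
(* Pairs from Psi and [Der R] map onto both sides; [Psi_derK_of_inner] matches the kernels. *)
- pose f (p : (subm (Psi X R) * Der R)%type) :=
    quotm_pi (inner (incidence X R)) (val p.1 + derK_of X p.2).
  pose g (p : (subm (Psi X R) * Der R)%type) :=
    (quotm_pi (inside (Psi X R) (Psi0 X R)) p.1, quotm_pi (inner R) p.2).
  apply: (@lmod_iso_surj _ _ _ _ f g).
  + move=> t a b; rewrite /f -quotm_pi_linear; congr (quotm_pi _ _).
    rewrite -[X in val X]/(t *: a.1 + b.1) -[X in derK_of _ X]/(t *: a.2 + b.2).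
    by rewrite (linearP (val : subm (Psi X R) -> _)) derK_of_linear
      scalerDr addrACA.
  + by move=> t a b; rewrite /g /= !quotm_pi_linear.
  + move=> u; have [D <-] := quotm_pi_surj u.
    have [c [psi [eps [Ppsi ->]]]] := dec _ _ D.
    exists (Subm Ppsi, eps); apply: quotm_pi_eq.
    by rewrite opprD addrCA subrr addr0 -linearN /= inner_ad.
  + move=> [u v]; have [psi <-] := quotm_pi_surj u.
    by have [eps <-] := quotm_pi_surj v; exists (psi, eps).
  + move=> [psi eps]; split=> [/quotm_pi_eq0/(Psi_derK_of_inner _ (valP psi))|].
      by rewrite /g /= => -[? ?]; congr pair; apply/quotm_pi_eq0.
    move=> [/quotm_pi_eq0 psi0 /quotm_pi_eq0 eps0]; apply/quotm_pi_eq0.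
    exact/(Psi_derK_of_inner _ (valP psi)).
Qed.
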